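(* Let $(U,\mu)$ be a fuzzy Hilbert space (satisfying the standing assumptions in the context), let $K$ be a strongly fuzzy bounded linear operator on $U$, let $\{f_i\}_{i=1}^\infty$ be a fuzzy $K$-frame for $U$ with bounds $A,B$, and let $T$ be an invertible strongly fuzzy bounded linear operator on $U$ with $TK=KT$. Then $\{Tf_i\}_{i=1}^\infty$ is a fuzzy $K$-frame for $U$.
   Context: Let $U$ be a complex vector space with zero vector $\theta$. A fuzzy inner product on $U$ is a map $\mu:U\times U\times\mathbb C\to[0,1]$ such that for all $x,y,z\in U$, $s,t\in\mathbb C$: (FIP1) $\mu(x+y,z,|t|+|s|)\ge\min\{\mu(x,z,|t|),\mu(y,z,|s|)\}$; (FIP2) $\mu(x,y,|st|)\ge\min\{\mu(x,x,|s|^2),\mu(y,y,|t|^2)\}$; (FIP3) $\mu(x,y,t)=\mu(y,x,\overline t)$; (FIP4) $\mu(cx,y,t)=\mu(x,y,t/|c|)$ for $c\in\mathbb C\setminus\{0\}$; (FIP5) $\mu(x,x,t)=0$ for $t\in\mathbb C\setminus\mathbb R^+$; (FIP6) $\mu(x,x,t)=1$ for all $t>0$ iff $x=\theta$; (FIP7) $\mu(x,x,\cdot):\mathbb R\to[0,1]$ is non-decreasing with limit $1$ at $+\infty$. Put $N(x,t)=\mu(x,x,t^2)$ for $t>0$ and $N(x,t)=0$ for real $t\le0$. Standing assumptions: (FIP8) if $\mu(x,x,t^2)>0$ for all $t>0$ then $x=\theta$; (FIP9) the norms $\|x\|_\alpha=\inf\{t>0:N(x,t)\ge\alpha\}$,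 $\alpha\in(0,1)$ (the $\alpha$-norms, an ascending family of norms on $U$), satisfy the parallelogram law. Let $\langle\cdot,\cdot\rangle_\alpha$ be the inner product obtained from $\|\cdot\|_\alpha$ by polarization. $(U,\mu)$ is a fuzzy Hilbert space if $U$ is complete with respect to $\|\cdot\|_\alpha$ for every $\alpha\in(0,1)$. A linear operator $T$ on $U$ is strongly fuzzy bounded if there is $M>0$ with $N(Tx,s)\ge N(x,s/M)$ for all $x\in U,s\in\mathbb R$ (equivalently $\|Tx\|_\alpha\le M\|x\|_\alpha$ for all $x$ and all $\alpha\in(0,1)$, for some $M>0$). Every strongly fuzzy bounded linear operator $T$ on $U$ under consideration is taken to possess an adjoint $T^*$: a strongly fuzzy bounded linear operator on $U$ with $\langle x,Ty\rangle_\alpha=\langle T^*x,y\rangle_\alpha$ for all $x,y\in U$ and all $\alpha\in(0,1)$. For a strongly fuzzy bounded linear operator $K$ on $U$, a sequence $\{f_i\}_{i=1}^\infty$ in $U$ is a fuzzy $K$-frame for $U$ (with bounds $A,B$) if there are constants $0<A\le B<\infty$ with $A\|K^*f\|_\alpha^2\le\sum_{i=1}^\infty|\langle f,f_i\rangle_\alpha|^2\le B\|f\|_\alpha^2$ for all $f\in U$ and all $\alpha\in(0,1)$. *)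

(* Defs.v *)
From HB Require Import structures.
From mathcomp Require Import all_boot all_order all_algebra.
From mathcomp Require Import complex.
From mathcomp Require Import all_classical all_reals all_analysis.
Set Implicit Arguments.
Unset Strict Implicit.
Unset Printing Implicit Defensive.
Import Order.TTheory GRing.Theory Num.Theory.
Import numFieldNormedType.Exports.

Local Open Scope classical_set_scope.
Local Open Scope ring_scope.
Local Open Scope complex_scope.

(* For t : R[i], `0 < t` holds exactly when t is a positive real number, and
   `|t| : R[i] is the modulus of t seen as a complex number. *)
Record fuzzy_inner_product (R : realType) (U : lmodType R[i])
    (mu : U -> U -> R[i] -> R) : Prop := FuzzyInnerProduct {
  fip_range : forall x y t, 0 <= mu x y t <= 1 ;
  fip1 : forall x y z (s t : R[i]),
    Num.min (mu x z `|t|) (mu y z `|s|) <= mu (x + y) z (`|t| + `|s|) ;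
  fip2 : forall x y (s t : R[i]),
    Num.min (mu x x (`|s| ^+ 2)) (mu y y (`|t| ^+ 2)) <= mu x y `|s * t| ;
  fip3 : forall x y (t : R[i]), mu x y t = mu y x t^* ;
  fip4 : forall (c : R[i]) x y t, c != 0 -> mu (c *: x) y t = mu x y (t / `|c|) ;
  fip5 : forall x (t : R[i]), ~~ (0 < t) -> mu x x t = 0 ;
  fip6 : forall x, (forall t, 0 < t -> mu x x t = 1) <-> x = 0 ;
  fip7_mono : forall x (s t : R), s <= t -> mu x x s%:C <= mu x x t%:C ;
  fip7_lim : forall x, mu x x t%:C @[t --> +oo] --> (1 : R)
}.

Definition fnorm (R : realType) (U : lmodType R[i])
    (mu : U -> U -> R[i] -> R) (x : U) (t : R) : R :=
  if 0 < t then mu x x (t ^+ 2)%:C else 0.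

Definition anorm (R : realType) (U : lmodType R[i])
    (mu : U -> U -> R[i] -> R) (a : R) (x : U) : R :=
  inf [set t : R | 0 < t /\ a <= fnorm mu x t].

(* Polarization; linear in the first argument. *)
Definition ainner (R : realType) (U : lmodType R[i])
    (mu : U -> U -> R[i] -> R) (a : R) (x y : U) : R[i] :=
  ((anorm mu a (x + y) ^+ 2 - anorm mu a (x - y) ^+ 2) / 4)
  +i* ((anorm mu a (x + (0 +i* 1) *: y) ^+ 2
        - anorm mu a (x - (0 +i* 1) *: y) ^+ 2) / 4).

Record fuzzy_hilbert (R : realType) (U : lmodType R[i])
    (mu : U -> U -> R[i] -> R) : Prop := FuzzyHilbert {
  fh_fip : fuzzy_inner_product mu ;
  fh_fip8 : forall x, (forall t : R, 0 < t -> 0 < mu x x (t ^+ 2)%:C) -> x = 0 ;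
  fh_fip9 : forall a : R, 0 < a < 1 -> forall x y,
    anorm mu a (x + y) ^+ 2 + anorm mu a (x - y) ^+ 2 =
    2 * (anorm mu a x ^+ 2 + anorm mu a y ^+ 2) ;
  fh_complete : forall a : R, 0 < a < 1 -> forall u : nat -> U,
    (forall e : R, 0 < e -> exists n : nat, forall p q : nat,
       (n <= p)%N -> (n <= q)%N -> anorm mu a (u p - u q) < e) ->
    exists l : U, anorm mu a (u n - l) @[n --> \oo] --> (0 : R)
}.

Definition strongly_fuzzy_bounded (R : realType) (U : lmodType R[i])
    (mu : U -> U -> R[i] -> R) (T : U -> U) : Prop :=
  exists M : R, 0 < M /\
    forall (x : U) (s : R), fnorm mu x (s / M) <= fnorm mu (T x) s.

Definition is_fuzzy_adjoint (R : realType) (U : lmodType R[i])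
    (mu : U -> U -> R[i] -> R) (T S : U -> U) : Prop :=
  [/\ linear S, strongly_fuzzy_bounded mu S &
      forall a : R, 0 < a < 1 -> forall x y : U,
        ainner mu a x (T y) = ainner mu a (S x) y].

Definition has_fuzzy_adjoint (R : realType) (U : lmodType R[i])
    (mu : U -> U -> R[i] -> R) (T : U -> U) : Prop :=
  exists S : U -> U, is_fuzzy_adjoint mu T S.

(* The adjoint of T, which is unique in a fuzzy Hilbert space; the identity is
   a junk value for operators without adjoint. *)
Definition fuzzy_adjoint (R : realType) (U : lmodType R[i])
    (mu : U -> U -> R[i] -> R) (T : U -> U) : U -> U :=
  xget (idfun : U -> U) [set S : U -> U | is_fuzzy_adjoint mu T S].

(* The sum of squares is taken in \bar R, so the upper bound contains the
   convergence of the series. *)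
Definition fuzzy_Kframe_bounds (R : realType) (U : lmodType R[i])
    (mu : U -> U -> R[i] -> R) (K : U -> U) (f : nat -> U) (A B : R) : Prop :=
  [/\ 0 < A, A <= B &
      forall (a : R) (g : U), 0 < a < 1 ->
        let S := (\sum_(0 <= i <oo) (Normc.normc (ainner mu a g (f i)) ^+ 2)%:E)%E in
        ((A * anorm mu a (fuzzy_adjoint mu K g) ^+ 2)%:E <= S)%E /\
        (S <= (B * anorm mu a g ^+ 2)%:E)%E].

Definition fuzzy_Kframe (R : realType) (U : lmodType R[i])
    (mu : U -> U -> R[i] -> R) (K : U -> U) (f : nat -> U) : Prop :=
  exists A B : R, fuzzy_Kframe_bounds mu K f A B.

(* Main.v *)
(* Writing T' for the adjoint of T, one has <g, T f_i> = <T' g, f_i> and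
   K' T' = T' K', so everything reduces to a lower bound c |h| <= |T' h| whose
   constant c serves all alpha-norms at once.  In one fixed alpha-norm it follows
   from the bounded inverse theorem.  It transfers to the others because they are
   all equivalent (they are ordered and complete) and T T' is symmetric for each
   of them: for large n the operator n - T T' has norm at most r < n in the fixed
   norm, hence its powers grow at most like r^k in every alpha-norm, and for a
   symmetric operator this growth rate bounds the norm itself. *)
Require Import Defs.
From mathcomp Require Import all_boot all_order all_algebra.
From mathcomp Require Import complex.
From mathcomp Require Import all_classical all_reals all_analysis.
From mathcomp Require Import ring lra.
Set Implicit Arguments.
Unset Strict Implicit.
Unset Printing Implicit Defensive.
Local Open Scope classical_set_scope.
Local Open Scope ring_scope.
Local Open Scope complex_scope.
Import Order.TTheory GRing.Theory Num.Theory.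
Import numFieldNormedType.Exports.

(** * Norms homogeneous over real scalars, and the equivalence of comparable complete norms *)

Record is_norm (R : realType) (U : lmodType R[i]) (p : U -> R) : Prop := IsNorm {
  norm_triangle : forall x y, p (x + y) <= p x + p y ;
  norm_homog : forall (c : R) x, p (c%:C *: x) = `|c| * p x ;
  norm_sep : forall x, p x = 0 -> x = 0
}.

Definition norm_complete (R : realType) (U : lmodType R[i]) (p : U -> R) : Prop :=
  forall u : nat -> U,
    (forall e : R, 0 < e -> exists n : nat, forall i j : nat,
       (n <= i)%N -> (n <= j)%N -> p (u i - u j) < e) ->
    exists l : U, p (u n - l) @[n --> \oo] --> (0 : R).

(* The real part of the inner product that polarization attaches to [p]. *)
Definition normdot (R : realType) (U : lmodType R[i]) (p : U -> R) (x y : U) : R :=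
  (p (x + y) ^+ 2 - p x ^+ 2 - p y ^+ 2) / 2.

Section Norms.
Context {R : realType} {U : lmodType R[i]}.
Implicit Types (p q : U -> R) (x y z : U).

Lemma norm0 p : is_norm p -> p 0 = 0.
Proof. by move=> hp; rewrite -(scale0r 0) (norm_homog hp 0) normr0 mul0r. Qed.

Lemma normN p x : is_norm p -> p (- x) = p x.
Proof.
move=> hp; have := norm_homog hp (-1) x.
by rewrite rmorphN rmorph1 scaleN1r normrN normr1 mul1r.
Qed.

Lemma normMn p x n : is_norm p -> p (x *+ n) = n%:R * p x.
Proof.
move=> hp; have := norm_homog hp n%:R x.
by rewrite rmorph_nat scaler_nat ger0_norm.
Qed.

Lemma norm_ge0 p x : is_norm p -> 0 <= p x.
Proof.
move=> hp; have := norm_triangle hp x (- x).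
rewrite subrr norm0// normN//; lra.
Qed.

Lemma normBC p x y : is_norm p -> p (x - y) = p (y - x).
Proof. by move=> hp; rewrite -normN// opprB. Qed.

Lemma norm_triangle3 p x y z : is_norm p -> p (x - z) <= p (x - y) + p (y - z).
Proof.
move=> hp; have := norm_triangle hp (x - y) (y - z).
by rewrite addrA subrK.
Qed.

Lemma halving_le (r : nat -> R) k : (forall k, r k.+1 <= r k / 2) ->
  r k <= r 0%N * (2^-1) ^+ k.
Proof.
move=> hr; elim: k => [|k ih]; first by rewrite expr0 mulr1.
have := hr k; rewrite exprSr; lra.
Qed.

Lemma geometric_small (r q e : R) : `|q| < 1 -> 0 < e ->
  exists k : nat, r * q ^+ k < e.
Proof.
move=> q1 e0.
have h : r * q ^+ k @[k --> \oo] --> r * 0 by apply: cvgMr; exact: cvg_expr.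
rewrite mulr0 in h.
have /= [k _ hk] := @cvgr_lt _ _ _ _ _ _ h _ e0.
by exists k; apply: hk => /=.
Qed.

Lemma halving_small (r e : R) : 0 < e -> exists k : nat, r * (2^-1) ^+ k < e.
Proof. by apply: geometric_small; rewrite ger0_norm; lra. Qed.

(** Since [r k / 2 <= r k - r k.+1], the distances telescope: every later term stays within [r k] of
    [u k], and the limit inherits this bound. *)
Lemma geometric_limit p (u : nat -> U) (r : nat -> R) :
  is_norm p -> norm_complete p -> (forall k, 0 <= r k) ->
  (forall k, r k.+1 <= r k / 2) -> (forall k, p (u k.+1 - u k) <= r k / 2) ->
  exists l, forall k, p (u k - l) <= r k.
Proof.
move=> hp cp r0 hr hu.
have step m j : p (u (m + j)%N - u m) <= r m - r (m + j)%N.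
  elim: j => [|j ih]; first by rewrite addn0 !subrr norm0.
  have := norm_triangle3 (u (m + j.+1)%N) (u (m + j)%N) (u m) hp.
  have := hu (m + j)%N; have := hr (m + j)%N.
  rewrite !addnS; lra.
have far m i : (m <= i)%N -> p (u i - u m) <= r m.
  move=> mi; rewrite -(subnKC mi); have := step m (i - m)%N.
  have := r0 (m + (i - m))%N; lra.
have [l hl] : exists l : U, p (u n - l) @[n --> \oo] --> (0 : R).
  apply: cp => e e0; have e2 : 0 < e / 2 by lra.
  have [n hn] := halving_small (r 0%N) e2.
  exists n => i j ni nj.
  have := norm_triangle3 (u i) (u n) (u j) hp.
  rewrite (normBC (u n) (u j) hp).
  have := far _ _ ni; have := far _ _ nj; have := halving_le n hr; lra.
exists l => k; apply/ler_addgt0Pr => e e0.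
have /= [n _ hn] := @cvgr_lt _ _ _ _ _ _ hl _ e0.
have := hn (maxn n k) (leq_maxl _ _) => /=.
have := far _ _ (leq_maxr n k).
have := norm_triangle3 (u k) (u (maxn n k)) l hp.
rewrite (normBC (u k) (u (maxn n k)) hp); lra.
Qed.

(* The Baire category argument: otherwise nested [p]-balls can be chosen so
   that the [n]-th one misses the [p]-closure of the [q]-ball of radius [n],
   and their common point has no [q]-norm. *)
Lemma norm_ball_almost_absorbing p q :
  is_norm p -> norm_complete p -> is_norm q ->
  exists2 C : R, 0 < C & forall x (e : R), 0 < e ->
    exists2 y, q y <= C * p x & p (x - y) < e.
Proof.
move=> hp cp hq; apply: contrapT => nG.
(* A pair is a closed [p]-ball, given by centre and radius; the new ball lies in the old one and
   misses the [q]-ball of radius [n]. *)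
have step (n : nat) (s : U * R) : exists s' : U * R, 0 < s.2 ->
    [/\ 0 < s'.2, s'.2 <= s.2 / 2, p (s'.1 - s.1) <= s.2 / 2 &
      forall y, q y <= n%:R -> s'.2 < p (s'.1 - y)].
  case: s => x r /=; apply: contrapT => /forallNP hs.
  have r0 : 0 < r.
    by rewrite ltNge; apply/negP => r0; apply: (hs (0, 0)) => r1; lra.
  (* If no such smaller ball exists, the [q]-ball of radius [n] comes [p]-close to every point
     within [r / 2] of [x]. *)
  have near0 x' e : p (x' - x) <= r / 2 -> 0 < e ->
      exists2 y, q y <= n%:R & p (x' - y) < e.
    move=> hx' e0; apply: contrapT => hy.
    apply: (hs (x', Num.min (r / 2) (e / 2))) => _ /=; split => //.
    - by rewrite lt_min; apply/andP; split; lra.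
    - by rewrite ge_min lexx.
    - move=> y qy; rewrite ltNge; apply/negP => pxy; apply: hy; exists y => //.
      by move: pxy; rewrite le_min => /andP[_]; lra.
  (* [z] is rescaled by [t] to [p]-length [r / 2]; half the difference of approximants of [x + t z]
     and [x - t z] approximates [t z]. Using [n.+1] keeps the constant positive when [n = 0]. *)
  apply: nG; exists (2 * n.+1%:R / r); first by rewrite divr_gt0// mulr_gt0.
  move=> z e e0.
  have [pz|pz] := eqVneq (p z) 0.
    by exists 0; rewrite ?subr0 ?pz ?norm0// mulr0.
  have {}pz : 0 < p z by rewrite lt_neqAle eq_sym pz norm_ge0.
  pose t := r / 2 / p z; have t0 : 0 < t by rewrite !divr_gt0.
  have et : 0 < e * t by rewrite mulr_gt0.
  have pw : p (t%:C *: z) = r / 2.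
    by rewrite (norm_homog hp) gtr0_norm// /t divfK// gt_eqF.
  have [y1 q1 p1] : exists2 y, q y <= n%:R & p (x + t%:C *: z - y) < e * t.
    by apply: near0 => //; rewrite addrAC subrr add0r pw.
  have [y2 q2 p2] : exists2 y, q y <= n%:R & p (x - t%:C *: z - y) < e * t.
    by apply: near0 => //; rewrite addrAC subrr add0r normN// pw.
  have c0 : 0 < (2 * t)^-1 by rewrite invr_gt0 mulr_gt0.
  exists (((2 * t)^-1)%:C *: (y1 - y2)).
    rewrite (norm_homog hq) gtr0_norm//.
    have -> : 2 * n.+1%:R / r * p z = (2 * t)^-1 * (2 * n.+1%:R).
      by rewrite /t; field; rewrite !gt_eqF.
    rewrite ler_pM2l//; have := norm_triangle hq y1 (- y2); rewrite normN//.
    have : (n%:R : R) <= n.+1%:R by rewrite ler_nat.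
    lra.
  have -> : z - ((2 * t)^-1)%:C *: (y1 - y2) =
      ((2 * t)^-1)%:C *: ((x + t%:C *: z - y1) - (x - t%:C *: z - y2)).
    have -> : (x + t%:C *: z - y1) - (x - t%:C *: z - y2) =
        (2 * t)%:C *: z - (y1 - y2).
      have -> : (2 * t)%:C *: z = t%:C *: z + t%:C *: z.
        by rewrite mulr_natl mulr2n rmorphD scalerDl.
      rewrite !opprB !addrA (ACl (1 * 6 * (2 * 5 * 4 * 3)))/=.
      by rewrite subrr add0r.
    rewrite [RHS]scalerBr scalerA -rmorphM mulVf ?scale1r//.
    by rewrite gt_eqF// mulr_gt0.
  rewrite (norm_homog hp) gtr0_norm//.
  have -> : e = (2 * t)^-1 * (2 * (e * t)) by field; rewrite gt_eqF.
  rewrite ltr_pM2l//.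
  have := norm_triangle hp (x + t%:C *: z - y1) (- (x - t%:C *: z - y2)).
  rewrite normN//; lra.
have [next hnext] : exists next : nat -> U * R -> U * R, forall n s, 0 < s.2 ->
    [/\ 0 < (next n s).2, (next n s).2 <= s.2 / 2,
      p ((next n s).1 - s.1) <= s.2 / 2 &
      forall y, q y <= n%:R -> (next n s).2 < p ((next n s).1 - y)].
  have /choice[F hF] : forall ns : nat * (U * R), exists s', 0 < ns.2.2 ->
      [/\ 0 < s'.2, s'.2 <= ns.2.2 / 2, p (s'.1 - ns.2.1) <= ns.2.2 / 2 &
        forall y, q y <= ns.1%:R -> s'.2 < p (s'.1 - y)].
    by move=> [n s]; exact: step.
  by exists (fun n s => F (n, s)) => n s; exact: (hF (n, s)).
pose s := fix s n := if n is m.+1 then next m (s m) else (0 : U, 1 : R).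
have s0 n : 0 < (s n).2.
  by elim: n => [|n ih] //=; have [] := hnext n _ ih.
have [l hl] : exists l, forall k, p ((s k).1 - l) <= (s k).2.
  apply: geometric_limit => // k; first exact: ltW.
    by have [] := hnext k _ (s0 k).
  by have [] := hnext k _ (s0 k).
have [n hn] : exists n : nat, q l <= n%:R.
  by exists (Num.bound (q l)); apply/ltW/archi_boundP/norm_ge0.
have [_ _ _ /(_ _ hn)] := hnext n _ (s0 n).
by rewrite ltNge => /negP; apply; exact: (hl n.+1).
Qed.

(** The bounded inverse theorem for the identity map. Subtracting from a vector an approximant of
    controlled [q]-norm halves its [p]-norm; iterating on the remainder gives a series that
    converges in [q]. *)
Theorem complete_norms_equivalent p q (c : R) :
  is_norm p -> norm_complete p -> is_norm q -> norm_complete q ->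
  0 < c -> (forall x, p x <= c * q x) ->
  exists2 D : R, 0 < D & forall x, q x <= D * p x.
Proof.
move=> hp cp hq cq c0 pq.
have [C C0 hC] := norm_ball_almost_absorbing hp cp hq.
have /choice[Y hY] : forall x, exists y, q y <= C * p x /\ p (x - y) <= p x / 2.
  move=> x; have [px|px] := eqVneq (p x) 0.
    by exists 0; rewrite subr0 px norm0// mulr0 mul0r.
  have px2 : 0 < p x / 2.
    by rewrite divr_gt0// lt_neqAle eq_sym px norm_ge0.
  by have [y ? /ltW ?] := hC x _ px2; exists y.
exists (2 * C) => [|x]; first by rewrite mulr_gt0.
(* [w k] is the remainder after [k] corrections, so [x - w k] is the partial sum. *)
pose w := fix w n := if n is m.+1 then w m - Y (w m) else x.
have [l hl] : exists l, forall k, q ((x - w k) - l) <= 2 * C * p (w k).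
  apply: geometric_limit => // k.
  - by rewrite mulr_ge0 ?norm_ge0// mulr_ge0// ltW.
  - have [_ h] := hY (w k).
    by rewrite -[leRHS]mulrA ler_pM2l ?mulr_gt0.
  - have [h _] := hY (w k) => /=.
    have -> : x - (w k - Y (w k)) - (x - w k) = Y (w k).
      by rewrite !opprB !addrA (ACl (1 * 5 * (3 * 4) * 2))/= subrr addNr !add0r.
    lra.
have wk k : p (w k) <= p x * (2^-1) ^+ k.
  by apply: (halving_le (r := p \o w)) => j /=; have [] := hY (w j).
(* At [k = 0] the bound is the claim once [l = x]. This holds because [p <= c * q] makes the partial
   sums converge to [l] in [p] too, while the remainders vanish in [p]. *)
suff lx : l = x by have := hl 0%N; rewrite /= subrr sub0r normN// lx.
apply/eqP; rewrite eq_sym -subr_eq0; apply/eqP/(norm_sep hp)/le_anti.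
rewrite norm_ge0// andbT; apply/ler_addgt0Pr => e e0; rewrite add0r.
have [k hk] := halving_small ((1 + c * (2 * C)) * p x) e0.
apply: le_trans (ltW hk).
have := norm_triangle hp (w k) (x - w k - l).
have -> : w k + (x - w k - l) = x - l by rewrite addrA [w k + _]addrC subrK.
have h1 := pq (x - w k - l).
have h2 : c * q (x - w k - l) <= c * (2 * C * p (w k)) by rewrite ler_pM2l.
have h3 : (1 + c * (2 * C)) * p (w k) <= (1 + c * (2 * C)) * (p x * (2^-1) ^+ k).
  by rewrite ler_pM2l// addr_gt0// !mulr_gt0.
move: h1 h2 h3; rewrite mulrA; lra.
Qed.

End Norms.

(** * Norms with the parallelogram law and their real inner products *)

Section ParallelogramNorm.
Context {R : realType} {U : lmodType R[i]} (p : U -> R).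
Hypothesis hp : is_norm p.
Hypothesis parallelogram : forall x y,
  p (x + y) ^+ 2 + p (x - y) ^+ 2 = 2 * (p x ^+ 2 + p y ^+ 2).
Implicit Types x y z : U.

Lemma normdotC x y : normdot p x y = normdot p y x.
Proof. by rewrite /normdot addrC [x + y]addrC; ring. Qed.

Lemma normdotE x y : normdot p x y = (p (x + y) ^+ 2 - p (x - y) ^+ 2) / 4.
Proof. rewrite /normdot; have := parallelogram x y; lra. Qed.

(** The additive half of the Jordan-von Neumann theorem: four parallelogram identities are combined
    so that the terms in [x + y - z] and [y + z - x] cancel. *)
Lemma normdotDl x y z : normdot p (x + y) z = normdot p x z + normdot p y z.
Proof.
rewrite /normdot.
have h1 := parallelogram (x + y) z.
have h2 := parallelogram (y + z) x.
have h3 := parallelogram y (x - z).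
have h4 := parallelogram x z.
have e1 : y + z + x = x + y + z by rewrite addrC addrA.
have e2 : y + (x - z) = x + y - z by rewrite addrA [y + x]addrC.
have e3 : y - (x - z) = y + z - x by rewrite opprB addrA.
move: h1 h2 h3 h4; rewrite e1 e2 e3; lra.
Qed.

Lemma normdotMnl x y n : normdot p (x *+ n) y = n%:R * normdot p x y.
Proof.
elim: n => [|n ih].
  by rewrite mulr0n mul0r /normdot add0r norm0// expr0n/=; ring.
by rewrite mulrS normdotDl ih -natr1; ring.
Qed.

Lemma normdotNl x y : normdot p (- x) y = - normdot p x y.
Proof.
have := normdotDl x (- x) y; rewrite subrr -(mulr0n 0) normdotMnl; lra.
Qed.

Lemma normdotxx x : normdot p x x = p x ^+ 2.
Proof. by rewrite /normdot -mulr2n normMn//; field. Qed.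

Lemma normdot_CauchySchwarz x y : normdot p x y <= p x * p y.
Proof.
have h : p (x + y) ^+ 2 <= (p x + p y) ^+ 2.
  by rewrite ler_sqr ?nnegrE ?addr_ge0 ?norm_ge0//; exact: norm_triangle.
rewrite /normdot; nra.
Qed.

Lemma normdot_inj x x' : (forall y, normdot p x y = normdot p x' y) -> x = x'.
Proof.
move=> h; apply/eqP; rewrite -subr_eq0; apply/eqP/(norm_sep hp)/eqP.
by rewrite -sqrf_eq0 -normdotxx normdotDl normdotNl h subrr.
Qed.

(* [p (E^k x)] is log-convex in [k], so a first ratio above [r] would persist
   and beat the growth rate [r] imposed by [p0]. *)
Lemma symmetric_operator_bound (p0 : U -> R) (E : U -> U) (r D : R) :
  is_norm p0 -> 0 < D -> (forall x, p x <= D * p0 x) ->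
  (forall x y, normdot p (E x) y = normdot p x (E y)) ->
  0 < r -> (forall x, p0 (E x) <= r * p0 x) ->
  forall x, p (E x) <= r * p x.
Proof.
move=> hp0 D0 pD Esym r0 p0E x.
have iterp0 k : p (iter k E x) <= D * (r ^+ k * p0 x).
  apply: le_trans (pD _) _; rewrite ler_pM2l//.
  elim: k => [|k ih]; first by rewrite expr0 mul1r.
  apply: le_trans (p0E _) _.
  by rewrite exprS -mulrA ler_pM2l.
have [px|px] := eqVneq (p x) 0.
  have := iterp0 1%N; rewrite /= (norm_sep hp px) !norm0// !mulr0; lra.
have {}px : 0 < p x by rewrite lt_neqAle eq_sym px norm_ge0.
rewrite leNgt; apply/negP => rE.
pose s := p (E x) / p x.
have rs : r < s by rewrite /s ltr_pdivlMr.
have s0 : 0 < s by apply: lt_trans rs.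
have ratio k : 0 < p (iter k E x) /\ s * p (iter k E x) <= p (iter k.+1 E x).
  elim: k => [|k [h1 h2]]; first by rewrite /= /s divfK// gt_eqF.
  have h3 : 0 < p (iter k.+1 E x) by apply: lt_le_trans h2; exact: mulr_gt0.
  split=> //.
  (* Log-convexity: symmetry moves one [E] across the product, then Cauchy-Schwarz applies. *)
  have h4 : p (iter k.+1 E x) ^+ 2 <= p (iter k E x) * p (iter k.+2 E x).
    by rewrite -normdotxx {1}iterS Esym; exact: normdot_CauchySchwarz.
  rewrite -(ler_pM2l h1); apply: le_trans h4.
  by rewrite mulrA [_ * s]mulrC expr2 ler_pM2r.
have grow k : s ^+ k * p x <= p (iter k E x).
  elim: k => [|k ih]; first by rewrite expr0 mul1r.
  apply: le_trans (ratio k).2.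
  by rewrite exprS -mulrA ler_pM2l.
(* Since [r < s], the lower bound [s^k p x] eventually exceeds the upper bound [D r^k p0 x]. *)
have q1 : `|r / s| < 1.
  by rewrite gtr0_norm; [rewrite ltr_pdivrMr ?mul1r|exact: divr_gt0].
have [k] := geometric_small (D * p0 x) q1 px.
rewrite ltNge => /negP; apply.
rewrite expr_div_n mulrA ler_pdivlMr ?exprn_gt0// mulrC.
apply: le_trans (grow k) _; apply: le_trans (iterp0 k) _.
by rewrite mulrCA mulrC.
Qed.

End ParallelogramNorm.

(** * The alpha-norms of a fuzzy inner product *)

Lemma normc_real (R : rcfType) (x : R) : `|x%:C| = `|x|%:C.
Proof. by rewrite normc_def/= expr0n/= addr0 sqrtr_sqr. Qed.

Section AlphaNorms.
Context {R : realType} {U : lmodType R[i]} (mu : U -> U -> R[i] -> R).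
Hypothesis Hmu : fuzzy_hilbert mu.
Let fip := fh_fip Hmu.
Implicit Types (x y z : U) (a s t : R).

Lemma fip_symR x y t : mu x y t%:C = mu y x t%:C.
Proof. by rewrite (fip3 fip) conjc_real. Qed.

Lemma fip_addR x y z s t : 0 <= s -> 0 <= t ->
  Num.min (mu x z s%:C) (mu y z t%:C) <= mu (x + y) z (s + t)%:C.
Proof.
move=> s0 t0; have := fip1 fip x y z t%:C s%:C.
by rewrite !normc_real !ger0_norm// rmorphD.
Qed.

Lemma fip_mulR x y s t : 0 <= s -> 0 <= t ->
  Num.min (mu x x (s ^+ 2)%:C) (mu y y (t ^+ 2)%:C) <= mu x y (s * t)%:C.
Proof.
move=> s0 t0; have := fip2 fip x y s%:C t%:C.
by rewrite -rmorphM !normc_real !ger0_norm ?mulr_ge0// !rmorphXn.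
Qed.

Lemma fnorm_gt0 x t : 0 < t -> fnorm mu x t = mu x x (t ^+ 2)%:C.
Proof. by rewrite /fnorm => ->. Qed.

Lemma fnorm_mono x s t : s <= t -> fnorm mu x s <= fnorm mu x t.
Proof.
move=> st; rewrite /fnorm; case: ifPn => [s0|_].
  have t0 : 0 < t by apply: lt_le_trans st.
  by rewrite t0 (fip7_mono fip)// ler_sqr ?nnegrE// ltW.
by case: ifPn => // _; have /andP[] := fip_range fip x x (t ^+ 2)%:C.
Qed.

Lemma fnorm_attains x a : a < 1 -> exists2 t, 0 < t & a <= fnorm mu x t.
Proof.
move=> a1.
have h : \forall t \near +oo, a < mu x x t%:C.
  exact: (@cvgr_gt _ _ _ _ _ _ (fip7_lim fip x) _ a1).
have [t [t0 ht]] : exists t : R, 0 < t /\ a < mu x x t%:C.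
  have [B [_ hB]] := h; exists (`|B| + 1); split; first exact: ltr_pwDr.
  by apply: hB; have := ler_norm B; lra.
exists (Num.sqrt t); first by rewrite sqrtr_gt0.
by rewrite fnorm_gt0 ?sqrtr_gt0// sqr_sqrtr ltW.
Qed.

(** [(s + t)^2] is split the way [<x + y, x + y>] expands: the diagonal terms go with [s^2] and
    [t^2], and FIP2 handles the mixed terms at [s t]. *)
Lemma fnorm_triangle x y s t : 0 < s -> 0 < t ->
  Num.min (fnorm mu x s) (fnorm mu y t) <= fnorm mu (x + y) (s + t).
Proof.
move=> s0 t0; rewrite !fnorm_gt0 ?addr_gt0//.
have st : (s + t) ^+ 2 = (s ^+ 2 + s * t) + (s * t + t ^+ 2) by ring.
have ss := sqr_ge0 s; have tt := sqr_ge0 t.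
have s1 := ltW s0; have t1 := ltW t0; have st1 := mulr_ge0 s1 t1.
rewrite st; apply: le_trans; last by apply: fip_addR; rewrite addr_ge0.
have mxy : Num.min (mu x x (s ^+ 2)%:C) (mu y y (t ^+ 2)%:C) <= mu x y (s * t)%:C.
  exact: fip_mulR.
rewrite le_min; apply/andP; split; rewrite [leRHS]fip_symR.
  apply: le_trans; last by apply: fip_addR.
  by rewrite le_min ge_min lexx/= [leRHS]fip_symR.
apply: le_trans; last by apply: fip_addR.
by rewrite le_min mxy ge_min lexx orbT.
Qed.

Lemma fnormZ x (c t : R) : c != 0 -> fnorm mu (c%:C *: x) t = fnorm mu x (t / `|c|).
Proof.
move=> c0; have c0' : c%:C != 0 by rewrite fmorph_eq0.
rewrite /fnorm ltr_pdivlMr ?normr_gt0// mul0r; case: ifPn => // _.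
have dv (r : R) : r%:C / `|c%:C| = (r / `|c|)%:C by rewrite normc_real fmorph_div.
rewrite (fip4 fip)// dv fip_symR (fip4 fip)// dv; congr (mu _ _ _%:C).
by rewrite expr_div_n expr2 invfM mulrA.
Qed.

Section FixedAlpha.
Variable a : R.
Hypothesis a01 : 0 < a < 1.

Let level x := [set t : R | 0 < t /\ a <= fnorm mu x t].

Lemma level_has_lbound x : has_lbound (level x).
Proof. by exists 0 => t [/ltW]. Qed.

Lemma level_nonempty x : level x !=set0.
Proof. by have /andP[_ /(fnorm_attains x)[t ? ?]] := a01; exists t. Qed.

Lemma anorm_le x t : 0 < t -> a <= fnorm mu x t -> anorm mu a x <= t.
Proof. by move=> t0 at_; apply: ge_inf => //; exact: level_has_lbound. Qed.

(** Strictness gives a point of the level set below [t], and monotonicity carries it up to [t]; this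
    is why later estimates carry a slack [e]. *)
Lemma le_fnorm x t : anorm mu a x < t -> a <= fnorm mu x t.
Proof.
move=> xt; have [s [s0 as_] st] := inf_lt (level_nonempty x) xt.
by apply: le_trans as_ _; apply: fnorm_mono; exact: ltW.
Qed.

Lemma anorm_ge0 x : 0 <= anorm mu a x.
Proof. by apply: lb_le_inf; [exact: level_nonempty|move=> t [/ltW]]. Qed.

Lemma anorm_leM x y (k : R) : 0 < k ->
  (forall t, fnorm mu x (t / k) <= fnorm mu y t) ->
  anorm mu a y <= k * anorm mu a x.
Proof.
move=> k0 h; apply/ler_addgt0Pr => e e0.
have ek : 0 < e / k by rewrite divr_gt0.
have -> : k * anorm mu a x + e = k * (anorm mu a x + e / k).
  by field; rewrite gt_eqF.
apply: anorm_le; first by rewrite mulr_gt0// ltr_wpDl// anorm_ge0.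
apply: le_trans (h _).
by rewrite mulrC mulKf ?gt_eqF//; apply: le_fnorm; rewrite ltrDl.
Qed.

Lemma anorm_is_norm : is_norm (anorm mu a).
Proof.
have homog_le (c : R) x : c != 0 -> anorm mu a (c%:C *: x) <= `|c| * anorm mu a x.
  move=> c0; apply: anorm_leM; first by rewrite normr_gt0.
  by move=> t; rewrite fnormZ.
split=> [x y|c x|x x0].
- apply/ler_addgt0Pr => e e0; have e2 : 0 < e / 2 by lra.
  have -> : anorm mu a x + anorm mu a y + e =
    (anorm mu a x + e / 2) + (anorm mu a y + e / 2) by field.
  have hx := anorm_ge0 x; have hy := anorm_ge0 y.
  apply: anorm_le; first lra.
  apply: le_trans (fnorm_triangle _ _ _ _); [|lra|lra].
  by rewrite le_min !le_fnorm// ltrDl.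
- have [->|c0] := eqVneq c 0.
    rewrite scale0r normr0 mul0r; apply: le_anti; rewrite anorm_ge0 andbT.
    apply/ler_addgt0Pr => e e0; rewrite add0r; apply: anorm_le => //.
    rewrite fnorm_gt0// (fip6 fip 0).2//; last by rewrite ltcR exprn_gt0.
    by have /andP[_ /ltW] := a01.
  apply: le_anti; rewrite homog_le//=.
  have := homog_le c^-1 (c%:C *: x); rewrite invr_eq0 scalerA -rmorphM mulVf//.
  rewrite scale1r normfV => /(_ c0).
  by rewrite ler_pdivlMl ?normr_gt0.
- apply: (fh_fip8 Hmu) => t t0; rewrite -fnorm_gt0//.
  have /andP[a0 _] := a01; apply: lt_le_trans a0 _.
  by apply: le_fnorm; rewrite x0.
Qed.

Lemma anorm_complete : norm_complete (anorm mu a).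
Proof. exact: (fh_complete Hmu a01). Qed.

(** The two polarization formulas agree by the parallelogram law, so adjoint identities can be used
    in real form. *)
Lemma Re_ainner x y : complex.Re (ainner mu a x y) = normdot (anorm mu a) x y.
Proof. by rewrite (normdotE (fh_fip9 Hmu a01)). Qed.

End FixedAlpha.

(** * Comparison of different alpha-norms, and operator bounds *)

Lemma anorm_ascending a b x : 0 < a -> a <= b -> b < 1 ->
  anorm mu a x <= anorm mu b x.
Proof.
move=> a0 ab b1.
have a01 : 0 < a < 1 by rewrite a0 (le_lt_trans ab).
have b01 : 0 < b < 1 by rewrite b1 (lt_le_trans a0).
apply/ler_addgt0Pr => e e0.
apply: anorm_le => //; first by rewrite ltr_wpDl// anorm_ge0.
by apply: le_trans ab _; apply: le_fnorm => //; rewrite ltrDl.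
Qed.

(** For [b <= a] the ascending order gives [D = 1]; for [a < b] it makes the norms comparable, and
    completeness reverses the inequality up to a constant. *)
Lemma anorm_le_anorm a b : 0 < a < 1 -> 0 < b < 1 ->
  exists2 D : R, 0 < D & forall x, anorm mu b x <= D * anorm mu a x.
Proof.
move=> a01 b01; have [ba|ab] := leP b a.
  exists 1 => // x; rewrite mul1r.
  by case/andP: a01 => _ a1; case/andP: b01 => b0 _; exact: anorm_ascending.
apply: (@complete_norms_equivalent _ _ _ _ 1) => //;
  [exact: anorm_is_norm|exact: anorm_complete|exact: anorm_is_norm|
   exact: anorm_complete|].
move=> x; rewrite mul1r; case/andP: a01 => a0 _; case/andP: b01 => _ b1.
by apply: anorm_ascending => //; exact: ltW.
Qed.

Lemma strongly_fuzzy_bounded_anorm (T : U -> U) : strongly_fuzzy_bounded mu T ->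
  exists2 M : R, 0 < M & forall a, 0 < a < 1 ->
    forall x, anorm mu a (T x) <= M * anorm mu a x.
Proof.
by move=> [M [M0 hM]]; exists M => // a a01 x; apply: anorm_leM.
Qed.

Lemma fuzzy_adjoint_normdot (T S : U -> U) a x y : is_fuzzy_adjoint mu T S ->
  0 < a < 1 -> normdot (anorm mu a) x (T y) = normdot (anorm mu a) (S x) y.
Proof. by move=> [_ _ h] a01; rewrite -!Re_ainner// h. Qed.

(** The map sending [x] to [anorm mu a (V x)] is a second complete norm, and boundedness of [T]
    compares it with [anorm mu a]; their equivalence is the bound on [V]. *)
Lemma bijective_anorm_inverse_bounded (T : {linear U -> U}) (V : U -> U) a :
  strongly_fuzzy_bounded mu T -> cancel T V -> cancel V T -> 0 < a < 1 ->
  exists2 C : R, 0 < C & forall x, anorm mu a (V x) <= C * anorm mu a x.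
Proof.
move=> /strongly_fuzzy_bounded_anorm[M M0 hM] TV VT a01.
have VD : {morph V : x y / x + y} by move=> x y; rewrite -{1}(VT x) -{1}(VT y) -raddfD TV.
have VZ c x : V (c *: x) = c *: V x by rewrite -{1}(VT x) -linearZ TV.
have VB x y : V (x - y) = V x - V y by rewrite VD -scaleN1r VZ scaleN1r.
have hp := anorm_is_norm a01; have cp := anorm_complete a01.
apply: (complete_norms_equivalent hp cp _ _ M0).
- split=> [x y|c x|x Vx0]; first by rewrite VD; exact: norm_triangle.
    by rewrite VZ; exact: norm_homog.
  by rewrite -(VT x) (norm_sep hp Vx0) raddf0.
- move=> u hu; have [l hl] : exists l : U,
      anorm mu a (V (u n) - l) @[n --> \oo] --> (0 : R).
    apply: cp => e e0; have [n hn] := hu e e0; exists n => i j ni nj.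
    by rewrite -VB hn.
  exists (T l); apply: cvg_trans hl; apply: near_eq_cvg; near=> n.
  by rewrite VB TV.
- by move=> x; rewrite -{1}(VT x); exact: hM.
Unshelve. all: by end_near. Qed.

(* The constant does not depend on [a]: for large [n] the operator [n - T S] is
   symmetric for every alpha-norm and has norm less than [n] for one of them,
   hence for all. *)
Lemma fuzzy_adjoint_bounded_below (T : {linear U -> U}) (S : U -> U) :
  strongly_fuzzy_bounded mu T -> is_fuzzy_adjoint mu T S -> bijective T ->
  exists2 c : R, 0 < c & forall a, 0 < a < 1 ->
    forall x, c * anorm mu a x <= anorm mu a (S x).
Proof.
move=> HT HS [V TV VT].
have [M M0 hM] := strongly_fuzzy_bounded_anorm HT.
have [linS sfbS _] := HS.
have [M' M'0 hM'] := strongly_fuzzy_bounded_anorm sfbS.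
have a01 : 0 < (2^-1 : R) < 1 by apply/andP; split; lra.
set a := (2^-1 : R) in a01.
pose p := anorm mu a.
have hp : is_norm p by exact: anorm_is_norm.
have pp := fh_fip9 Hmu a01.
have [C C0 hC] := bijective_anorm_inverse_bounded HT TV VT a01.
(* Here [|x|^2 = <x, T V x> = <S x, V x> <= |S x| C |x|]. *)
have pS x : p x <= C * p (S x).
  have [px|px] := eqVneq (p x) 0; first by rewrite px mulr_ge0 ?norm_ge0// ltW.
  have {}px : 0 < p x by rewrite lt_neqAle eq_sym px norm_ge0.
  rewrite -(ler_pM2r px) -expr2 -normdotxx// -{2}(VT x).
  rewrite (fuzzy_adjoint_normdot _ _ HS a01).
  apply: le_trans (normdot_CauchySchwarz hp _ _) _.
  rewrite [C * _]mulrC -mulrA ler_wpM2l ?norm_ge0//; exact: hC.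
pose d := (C ^+ 2)^-1; have d0 : 0 < d by rewrite invr_gt0 exprn_gt0.
have dS x : d * p x ^+ 2 <= p (S x) ^+ 2.
  rewrite /d ler_pdivrMl ?exprn_gt0// -exprMn ler_sqr ?nnegrE ?norm_ge0//.
  by rewrite mulr_ge0 ?norm_ge0// ltW.
pose k := (M * M') ^+ 2.
have pTS x : p (T (S x)) ^+ 2 <= k * p x ^+ 2.
  have Mge0 := ltW M0; have M'ge0 := ltW M'0.
  rewrite -exprMn ler_sqr ?nnegrE ?mulr_ge0 ?norm_ge0//.
  apply: le_trans (hM _ a01 _) _; rewrite -mulrA ler_pM2l//; exact: hM'.
(* [|E x|^2 <= (n^2 + k - 2 n d) |x|^2] for the [E] below, so [k <= n d] brings it under
   [r^2 |x|^2], while [d <= n] keeps [r] positive. *)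
have [n [nk nd]] : exists n : nat, k <= n%:R * d /\ d <= n%:R.
  exists (Num.bound (k / d + d)).
  have kd : 0 <= k / d by rewrite divr_ge0 ?sqr_ge0 ?ltW.
  have /archi_boundP h : 0 <= k / d + d by rewrite addr_ge0// ltW.
  by split; [rewrite -ler_pdivrMr//|]; lra.
pose r : R := n%:R - d / 2; have r0 : 0 < r by rewrite /r; lra.
pose E := fun x => x *+ n - T (S x).
have pE x : p (E x) <= r * p x.
  have rge0 := ltW r0.
  rewrite -ler_sqr ?nnegrE ?mulr_ge0 ?norm_ge0//.
  have h : p (E x) ^+ 2 =
      n%:R ^+ 2 * p x ^+ 2 + p (T (S x)) ^+ 2 - 2 * n%:R * p (S x) ^+ 2.
    have e1 : normdot p (x *+ n) (- T (S x)) = - (n%:R * p (S x) ^+ 2).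
      rewrite normdotC normdotNl// normdotC normdotMnl//.
      by rewrite (fuzzy_adjoint_normdot _ _ HS a01) normdotxx.
    by move: e1; rewrite /normdot normMn// normN// exprMn -/(E x); lra.
  have h1 := pTS x; have h2 := dS x.
  have h3 : n%:R * (d * p x ^+ 2) <= n%:R * p (S x) ^+ 2 by rewrite ler_wpM2l.
  have h4 : k * p x ^+ 2 <= n%:R * d * p x ^+ 2 by rewrite ler_wpM2r ?sqr_ge0.
  have h5 : 0 <= d ^+ 2 * p x ^+ 2 by rewrite mulr_ge0 ?sqr_ge0.
  have -> : (r * p x) ^+ 2 =
      (n%:R ^+ 2 - n%:R * d + d ^+ 2 / 4) * p x ^+ 2 by rewrite /r; field.
  rewrite h; lra.
(* The constant comes from [n |x| <= |E x| + |T S x| <= r |x| + M |S x|] with [n - r = d / 2]. *)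
exists (d / (2 * M)); first by rewrite divr_gt0// mulr_gt0.
move=> b b01 x; have hb := anorm_is_norm b01; have bb := fh_fip9 Hmu b01.
(* [D] depends on [b] but drops out of the operator bound, so [r] serves every alpha-norm. *)
have [D D0 hD] := anorm_le_anorm a01 b01.
(* [T S] is symmetric, because [<T S y, z> = <S y, S z> = <y, T S z>]. *)
have Esym y z : normdot (anorm mu b) (E y) z = normdot (anorm mu b) y (E z).
  rewrite [RHS]normdotC !normdotDl// !normdotNl// !normdotMnl//.
  rewrite [normdot _ (T (S y)) _]normdotC [normdot _ (T (S z)) _]normdotC.
  rewrite !(fuzzy_adjoint_normdot _ _ HS b01).
  by rewrite [normdot _ (S y) _]normdotC [normdot _ y _]normdotC.
have h1 := symmetric_operator_bound hb hp D0 hD Esym r0 pE x.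
have h2 := norm_triangle hb (E x) (T (S x)).
rewrite subrK normMn// in h2.
have h3 := hM b b01 (S x).
rewrite mulrAC ler_pdivrMr ?mulr_gt0//.
by move: h1; rewrite /r; lra.
Qed.

End AlphaNorms.

(** * The frame bounds of the image sequence *)

Theorem theorem4p4 (R : realType) (U : lmodType R[i])
    (mu : U -> U -> R[i] -> R) (Hmu : fuzzy_hilbert mu)
    (K : {linear U -> U}) (HK : strongly_fuzzy_bounded mu K)
    (HKadj : has_fuzzy_adjoint mu K)
    (f : nat -> U) (A B : R) (Hf : fuzzy_Kframe_bounds mu K f A B)
    (T : {linear U -> U}) (HT : strongly_fuzzy_bounded mu T)
    (HTadj : has_fuzzy_adjoint mu T)
    (Tinv : bijective T) (HTK : T \o K =1 K \o T) :
  fuzzy_Kframe mu K (fun i => T (f i)).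
Proof.
have HK' : is_fuzzy_adjoint mu K (fuzzy_adjoint mu K).
  by case: HKadj => S HS; exact: (xgetI _ HS).
have [S HS] := HTadj; have [_ sfbS adjS] := HS.
have [M M0 hM] := strongly_fuzzy_bounded_anorm Hmu sfbS.
have [c c0 hc] := fuzzy_adjoint_bounded_below Hmu HT HS Tinv.
have [A0 AB hf] := Hf.
pose K' := fuzzy_adjoint mu K.
(* Tested against [y], the two sides are [<g, T K y>] and [<g, K T y>]; one alpha is enough to
   separate vectors. *)
have comm g : K' (S g) = S (K' g).
  have a01 : 0 < (2^-1 : R) < 1 by apply/andP; split; lra.
  apply: (normdot_inj (anorm_is_norm Hmu a01) (fh_fip9 Hmu a01)) => y.
  rewrite -!(fuzzy_adjoint_normdot Hmu _ _ HK' a01).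
  rewrite -!(fuzzy_adjoint_normdot Hmu _ _ HS a01).
  rewrite -!(fuzzy_adjoint_normdot Hmu _ _ HK' a01).
  by have /= -> := HTK y.
have Ac0 : 0 < A * c ^+ 2 by rewrite mulr_gt0// exprn_gt0.
(* The maximum orders the two bounds without comparing [c] with [M]. *)
exists (A * c ^+ 2), (Num.max (A * c ^+ 2) (B * M ^+ 2)); split=> //.
  by rewrite le_max lexx.
move=> a g a01 S'.
(* As [<g, T f_i> = <S g, f_i>], the sum is the one of the original frame at [S g]. *)
have -> : S' = (\sum_(0 <= i <oo) (Normc.normc (ainner mu a (S g) (f i)) ^+ 2)%:E)%E.
  by apply: eq_eseriesr => i _; rewrite adjS.
have [lo hi] := hf a (S g) a01.
have nn x := anorm_ge0 Hmu a01 x.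
split.
  (* Lower bound: [c |K' g| <= |S K' g| = |K' S g|]. *)
  apply: le_trans lo; rewrite lee_fin -mulrA ler_pM2l// -exprMn.
  rewrite ler_sqr ?nnegrE ?mulr_ge0 ?nn//; last exact: ltW.
  by rewrite -/K' comm; exact: hc.
apply: le_trans hi _; rewrite lee_fin.
apply: (@le_trans _ _ (B * M ^+ 2 * anorm mu a g ^+ 2)).
  rewrite -mulrA ler_pM2l; last exact: lt_le_trans AB.
  have Mge0 := ltW M0.
  by rewrite -exprMn ler_sqr ?nnegrE ?mulr_ge0 ?nn// hM.
by rewrite ler_wpM2r ?sqr_ge0// le_max lexx orbT.
Qed.
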